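(* Let $i\in\{1,2\}$. Let $K\subset\Theta_1$ be a compact convex set with $0\in K$, and let $(\theta_{i,n})_{n\in\mathbb{N}}$ and $(\theta_{i,\varepsilon,n})_{n\in\mathbb{N}}$ be defined by $$\theta_{i,n+1}=\Pi_K\bigl[\theta_{i,n}-\gamma_{n+1}H_i(\theta_{i,n},L_{T,n+1})\bigr],\qquad \theta_{i,\varepsilon,n+1}=\Pi_K\bigl[\theta_{i,\varepsilon,n}-\gamma_{n+1}H_i(\theta_{i,\varepsilon,n},L^\varepsilon_{T,n+1})\bigr],$$ with the same initial value $\theta_{i,0}=\theta_{i,\varepsilon,0}\in K$. Then for all $n\in\mathbb{N}$, $$\theta_{i,\varepsilon,n}\longrightarrow\theta_{i,n}\quad\text{a.s. as }\varepsilon\to0 .$$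
   Context: $T>0$, $d\ge1$. $L=(L_t)_{t\ge 0}$ is an $\mathbb{R}^d$-valued pure-jump Lévy process with generating triplet $(\gamma,0,\nu)$, i.e. $\mathbb{E}e^{iu\cdot L_t}=\exp\{t(i\gamma\cdot u+\int_{\mathbb{R}^d}(e^{iu\cdot x}-1-iu\cdot x\mathbf{1}_{|x|\le1})\nu(dx))\}$. For $0<\varepsilon<1$, $$L_t^{\varepsilon}=\gamma t+\sum_{0<s\le t}\Delta L_s\mathbf{1}_{|\Delta L_s|>1}+\Bigl(\sum_{0<s\le t}\Delta L_s\mathbf{1}_{\varepsilon\le|\Delta L_s|\le1}-t\int_{\varepsilon\le|x|\le1}x\,\nu(dx)\Bigr),$$ so that $L_T^\varepsilon\to L_T$ a.s. as $\varepsilon\to0$. $F:\mathbb{R}^d\to\mathbb{R}$ is a given function (differentiable if $i=2$, so that $F_2$ is defined), $F_1=F^2$ and $F_2=\nabla F\cdot\Sigma\nabla F$; when $i=2$, $\Sigma$ is the positive definite matrix $\Sigma=\lim_{\varepsilon\to0}\sigma^{-2}(\varepsilon)\Sigma_\varepsilon$ (assumed to exist), where $\Sigma_\varepsilon=\int_{|x|\le\varepsilon}xx'\nu(dx)$, $\sigma^2(\varepsilon)=\mathrm{Tr}(\Sigma_\varepsilon)$. $\kappa(\theta)=\ln\mathbb{E}[e^{\theta\cdot L_1}]$; $\Theta_1=\{\theta\in\mathbb{R}^d:\int_{|x|>1}e^{\theta\cdot x}\nu(dx)<\infty\}$; $H_i(\theta,x)=(T\nabla\kappa(\theta)-x)F_i(x)e^{-\theta\cdot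 x+T\kappa(\theta)}$. $(L_{T,n},(L^\varepsilon_{T,n})_{\varepsilon})_{n\ge1}$ are i.i.d. copies of $(L_T,(L_T^\varepsilon)_{\varepsilon})$, so that $L^\varepsilon_{T,n}\to L_{T,n}$ a.s. as $\varepsilon\to0$ for each $n$; $\Pi_K$ is the Euclidean projection onto $K$; $(\gamma_n)_{n\ge1}$ is a decreasing sequence of positive reals with $\sum_n\gamma_n=\infty$ and $\sum_n\gamma_n^2<\infty$.
   Formalization: The formal theorem additionally assumes that F_i is almost surely continuous at L_T (the claim fails for arbitrary F) and that K lies in the interior of {κ<∞}, since ∇κ, hence H_i, is undefined at boundary points of Θ_1. *)

(* Defs.v *)
From HB Require Import structures.
From mathcomp Require Export all_boot all_order all_algebra.
From mathcomp Require Export complex.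
From mathcomp Require Export all_classical all_reals all_analysis.
Export Order.TTheory GRing.Theory Num.Theory.
Export numFieldNormedType.Exports.

Set Implicit Arguments.
Unset Strict Implicit.
Unset Printing Implicit Defensive.

Local Open Scope classical_set_scope.
Local Open Scope ring_scope.

Section euclidean.
Context {R : realType} {d : nat}.
Local Notation V := 'rV[R]_d.

Definition dot (u v : V) : R := \sum_(j < d) u 0 j * v 0 j.

(* The library's norm on matrices is the sup norm (same topology). *)
Definition enorm (u : V) : R := Num.sqrt (dot u u).

Definition grad (f : V -> R) (x : V) : V :=
  \row_j 'D_(delta_mx 0 j : V) f x.

Definition quad (M : 'M[R]_d) (u v : V) : R := (u *m M *m v^T) 0 0.

Definition posdefmx (M : 'M[R]_d) : Prop :=
  M^T = M /\ forall u : V, u != 0 -> 0 < quad M u u.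

(* Uniquely determined when K is nonempty, closed and convex. *)
Definition proj (K : set V) (x : V) : V :=
  get [set y | K y /\ forall z, K z -> enorm (x - y) <= enorm (x - z)].

End euclidean.

Definition borelV (R : realType) (d : nat) :=
  g_sigma_algebraType (@open 'rV[R]_d).

Section complex_integral.
Context {R : realType}.
Local Open Scope complex_scope.

Definition itimes (y : R) : R[i] := 0 +i* y.

Definition cexp (z : R[i]) : R[i] :=
  (expR (complex.Re z))%:C * (cos (complex.Im z) +i* sin (complex.Im z)).

Definition cintegral {dT} {T : measurableType dT}
    (mu : {measure set T -> \bar R}) (f : T -> R[i]) : R[i] :=
  (\int[mu]_x complex.Re (f x)) +i* (\int[mu]_x complex.Im (f x)).

End complex_integral.

Section levy.
Context {R : realType} {d : nat}.
Local Notation V := 'rV[R]_d.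
Local Notation bV := (borelV R d).

Definition levy_measure (nu : {measure set bV -> \bar R}) : Prop :=
  nu [set 0 : V] = 0%E /\
  (\int[nu]_x (Num.min (enorm (x : V) ^+ 2) 1)%:E < +oo)%E.

Definition Theta1 (nu : {measure set bV -> \bar R}) : set V :=
  [set theta | (\int[nu]_(x in [set x : V | (1 < enorm x)%R])
                  (expR (dot theta (x : V)))%:E < +oo)%E].

Definition cadlag (p : R -> V) : Prop :=
  (forall t : R, 0 <= t -> p s @[s --> t^'+] --> p t) /\
  (forall t : R, 0 < t -> cvg (p s @[s --> t^'-])).

Definition jump (p : R -> V) (t : R) : V := p t - lim (p s @[s --> t^'-]).

Definition incr {Omega : Type} (L : R -> Omega -> V) (s t : R) (w : Omega) : V :=
  L t w - L s w.

Section process.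
Context {dO} {Omega : measurableType dO} (P : probability Omega R).

(* Time is [0, +oo[ : the values of L at negative times are irrelevant. *)
Record levy_process (L : R -> Omega -> V) : Prop := {
  levy_measurable : forall t : R, 0 <= t -> measurable_fun setT (L t : Omega -> bV);
  levy_start : {ae P, forall w, L 0 w = 0};
  levy_indep : forall (n : nat) (t : nat -> R) (B : nat -> set bV),
    0 <= t 0%N -> (forall k, (k < n)%N -> t k <= t k.+1) ->
    (forall k, measurable (B k)) ->
    P (\bigcap_(k < n) incr L (t k) (t k.+1) @^-1` B k) =
    (\prod_(k < n) P (incr L (t k) (t k.+1) @^-1` B k))%E;
  levy_stationary : forall (s t : R) (B : set bV), 0 <= s -> 0 <= t ->
    measurable B ->
    P (incr L s (s + t) @^-1` B) = P (incr L 0 t @^-1` B);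
  levy_stoch_cont : forall t e : R, 0 <= t -> 0 < e ->
    P [set w | e < enorm (L s w - L t w)]
      @[s --> within [set s | 0 <= s] (nbhs t)] --> 0%E;
  levy_cadlag : forall w, cadlag (L ^~ w) }.

(* Levy-Khintchine formula for the generating triplet (gamma, 0, nu). *)
Definition pure_jump_triplet (L : R -> Omega -> V) (gamma : V)
    (nu : {measure set bV -> \bar R}) : Prop :=
  levy_measure nu /\
  forall (t : R) (u : V), 0 <= t ->
    cintegral P (fun w => cexp (itimes (dot u (L t w)))) =
    cexp ((t%:C)%C * (itimes (dot gamma u) +
      cintegral nu (fun x : V =>
        cexp (itimes (dot u x)) - 1
        - itimes (dot u x * \1_[set y : V | enorm y <= 1] x)))).

(* Valued in the extended reals: +oo where the exponential moment is infinite. *)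
Definition kappa (X : Omega -> V) (theta : V) : \bar R :=
  lne 'E_P[fun w => expR (dot theta (X w))].

End process.

(* The approximation L^eps_t of a path p; the two jump sums are finite since
   p is cadlag. *)
Definition Leps (gamma : V) (nu : {measure set bV -> \bar R}) (eps : R)
    (p : R -> V) (t : R) : V :=
  t *: gamma
  + \sum_(s \in [set s | 0 < s <= t /\ 1 < enorm (jump p s)]) jump p s
  + (\sum_(s \in [set s | 0 < s <= t /\ eps <= enorm (jump p s) <= 1]) jump p s
     - t *: \row_j \int[nu]_(x in [set x : V | eps <= enorm x <= 1])
                      ((x : V) 0 j)).

Definition Sigma_eps (nu : {measure set bV -> \bar R}) (eps : R) : 'M[R]_d :=
  \matrix_(j, k) \int[nu]_(x in [set x : V | enorm x <= eps])
                    ((x : V) 0 j * (x : V) 0 k).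

Definition sigma2 (nu : {measure set bV -> \bar R}) (eps : R) : R :=
  \tr (Sigma_eps nu eps).

End levy.

Section copies.
Context {R : realType} {d : nat}.
Local Notation V := 'rV[R]_d.
Local Notation bV := (borelV R d).

(* The pair (Z, (Ze eps)_(0 < eps < 1)) as one family indexed by eps_index. *)
Definition joint {T : Type} (Z : T -> V) (Ze : R -> T -> V) (o : option R) :
  T -> V := if o is Some eps then Ze eps else Z.

Definition eps_index : set (option R) :=
  [set o | if o is Some eps then 0 < eps < 1 else True].

(* Equality of the finite-dimensional distributions, i.e. of the laws on the
   product sigma-algebra. *)
Definition same_law {I : eqType} (D : set I)
    {d1} {T1 : measurableType d1} (P1 : probability T1 R) (Y1 : I -> T1 -> V)
    {d2} {T2 : measurableType d2} (P2 : probability T2 R) (Y2 : I -> T2 -> V)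
    : Prop :=
  forall (s : seq I) (B : I -> set bV), [set` s] `<=` D ->
    (forall i, measurable (B i)) ->
    P1 (\bigcap_(i in [set` s]) Y1 i @^-1` B i) =
    P2 (\bigcap_(i in [set` s]) Y2 i @^-1` B i).

Definition sigma_of {I : Type} (D : set I) {T : Type} (Y : I -> T -> V) :
  set (set T) :=
  <<s [set A | exists (i : I) (B : set bV), [/\ D i, measurable B & A = Y i @^-1` B]] >>.

Definition independent_sigma {I : eqType} (D : set I)
    {dT} {T : measurableType dT} (P : probability T R)
    (G : I -> set (set T)) : Prop :=
  forall (s : seq I) (A : I -> set T), uniq s -> [set` s] `<=` D ->
    (forall n, n \in s -> G n (A n)) ->
    P (\bigcap_(n in [set` s]) A n) = (\prod_(n <- s) P (A n))%E.

(* Indices start at n = 1: X 0 and Xe eps 0 are unconstrained. *)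
Record iid_copies
    {d0} {Omega0 : measurableType d0} (P0 : probability Omega0 R)
    (Z : Omega0 -> V) (Ze : R -> Omega0 -> V)
    {dO} {Omega : measurableType dO} (P : probability Omega R)
    (X : nat -> Omega -> V) (Xe : R -> nat -> Omega -> V) : Prop := {
  copies_measurable : forall n o, (0 < n)%N -> eps_index o ->
    measurable_fun setT (joint (X n) (Xe ^~ n) o : Omega -> bV);
  copies_law : forall n, (0 < n)%N ->
    same_law eps_index P0 (joint Z Ze) P (joint (X n) (Xe ^~ n));
  copies_indep : independent_sigma [set n | (0 < n)%N] P
    (fun n => sigma_of eps_index (joint (X n) (Xe ^~ n)));
  (* As the law is on the product sigma-algebra of an uncountable family, it
     does not carry this property from (L_T, L_T^eps) to the copies. *)
  copies_cvg : forall n, (0 < n)%N ->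
    {ae P, forall w, Xe eps n w @[eps --> 0^'+] --> X n w} }.

End copies.

Section algorithm.
Context {R : realType} {d : nat}.
Local Notation V := 'rV[R]_d.

(* Only i = 1 and i = 2 are meant. *)
Definition Fi (i : nat) (F : V -> R) (Sigma : 'M[R]_d) (x : V) : R :=
  if i == 1%N then F x ^+ 2 else quad Sigma (grad F x) (grad F x).

Definition Hi (T : R) (k : V -> \bar R) (Fi : V -> R) (theta x : V) : V :=
  (Fi x * expR (- dot theta x + T * fine (k theta))) *:
  (T *: grad (fine \o k) theta - x).

Fixpoint robbins_monro (K : set V) (H : V -> V -> V) (step : nat -> R)
    (theta0 : V) (x : nat -> V) (n : nat) : V :=
  if n is m.+1 then
    let theta := robbins_monro K H step theta0 x m in
    proj K (theta - step m.+1 *: H theta (x m.+1))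
  else theta0.

Definition step_sequence (step : nat -> R) : Prop :=
  [/\ forall n, (0 < n)%N -> 0 < step n,
      forall n, (0 < n)%N -> step n.+1 <= step n,
      \sum_(1 <= n < N) step n @[N --> \oo] --> +oo &
      cvgn (fun N => \sum_(1 <= n < N) step n ^+ 2)].

End algorithm.

(* Main.v *)
Require Import Defs.
From mathcomp Require Import ring lra measurable_realfun.

(** The iterates are obtained by alternating the map (theta, x) |-> H(theta, x)
    with a projection, so the claim follows by induction on n as soon as both
    maps are continuous at the points that matter.

    The projection onto a nonempty compact convex set is 1-Lipschitz for the
    Euclidean norm: the variational inequality (x - p).(z - p) <= 0 at the
    nearest point p, valid for every z in K ([proj_variational]), is applied at
    two points and the two inequalities are added ([proj_nonexpansive]).

    H depends on theta through kappa and its gradient, and all iterates stay in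
    K, which lies in the interior of the domain of the moment generating
    function M(theta) = E[exp(theta.X)].  There kappa = ln M is continuously
    differentiable.  Around an interior point theta every integrand is dominated
    by an integrable envelope exp(theta.X + a |X|_1), itself bounded by finitely
    many exponential moments at theta +- c e_j ([interior_envelope]).  The
    elementary bounds |e^y - 1| <= |y| e^|y| and |e^y - 1 - y| <= y^2 e^|y| then
    make E[phi(X) exp(theta.X)] locally Lipschitz for every phi of linear growth
    ([exp_moment_lipschitz]) and give a first order expansion of M with
    quadratic remainder ([mgf_taylor]); hence grad kappa = E[X exp(theta.X)] / M
    ([grad_kappa]) and it is continuous ([grad_kappa_continuous]).

    H depends on x through F_i, which is continuous almost surely at L_T.  The
    continuity points of any real function form a G_delta set
    ([continuity_pointsE]), so continuity of F_i at L_T is an event whose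
    probability only depends on the law of L_T, and each copy of L_T inherits it
    ([ae_continuity_transfer]).  On the almost sure event where all copies
    converge and are continuity points of F_i, the induction runs
    deterministically ([cvg_robbins_monro]). *)

Set Implicit Arguments.
Unset Strict Implicit.
Unset Printing Implicit Defensive.
Local Open Scope classical_set_scope.
Local Open Scope ring_scope.

(** * The inner product and the Euclidean projection *)

Section euclidean_space.
Context {R : realType} {d : nat}.
Local Notation V := 'rV[R]_d.
Implicit Types (u v w : V) (K : set V).

Lemma dotC u v : dot u v = dot v u.
Proof. by apply: eq_bigr => j _; rewrite mulrC. Qed.

Lemma dotDl u v w : dot (u + v) w = dot u w + dot v w.
Proof. by rewrite -big_split; apply: eq_bigr => j _; rewrite mxE mulrDl. Qed.

Lemma dotZl a u v : dot (a *: u) v = a * dot u v.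
Proof. by rewrite /dot mulr_sumr; apply: eq_bigr => j _; rewrite mxE mulrA. Qed.

Lemma dotNl u v : dot (- u) v = - dot u v.
Proof. by rewrite -scaleN1r dotZl mulN1r. Qed.

Lemma dotBl u v w : dot (u - v) w = dot u w - dot v w.
Proof. by rewrite dotDl dotNl. Qed.

Lemma dotBr u v w : dot w (u - v) = dot w u - dot w v.
Proof. by rewrite !(dotC w) dotBl. Qed.

Lemma dotZr a u v : dot u (a *: v) = a * dot u v.
Proof. by rewrite !(dotC u) dotZl. Qed.

Lemma dot_delta j u : dot (delta_mx 0 j) u = u 0 j.
Proof.
rewrite /dot (bigD1 j)//= mxE !eqxx mul1r big1 ?addr0// => k kj.
by rewrite mxE eqxx (negbTE kj) mul0r.
Qed.

Lemma dot_ge0 u : 0 <= dot u u.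
Proof. by apply: sumr_ge0 => j _; rewrite -expr2 sqr_ge0. Qed.

Lemma coord_le_enorm u j : `|u 0 j| <= enorm u.
Proof.
rewrite -sqrtr_sqr ler_sqrt ?dot_ge0// /dot (bigD1 j)//= -expr2 lerDl.
by apply: sumr_ge0 => k _; rewrite -expr2 sqr_ge0.
Qed.

Lemma coord_le_norm u j : `|u 0 j| <= `|u|.
Proof. by rewrite {2}/Num.norm/= mx_normrE (le_bigmax _ _ (0, j)). Qed.

Lemma norm_le_coord u e : 0 <= e -> (forall j, `|u 0 j| <= e) -> `|u| <= e.
Proof.
move=> e0 ue; have [->//|/mx_norm_neq0[[i j] ]] := eqVneq `|u| 0.
by rewrite {2}/Num.norm/= => -> /=; rewrite ord1.
Qed.

Lemma cvg_row {I : Type} (G : set_system I) {FG : Filter G} (f : I -> V) (l : V) :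
  (forall j, f x 0 j @[x --> G] --> l 0 j) -> f @ G --> l.
Proof.
move=> fl; apply/cvgrPdist_le => e e0.
have : \forall x \near G, forall j, `|l 0 j - f x 0 j| <= e.
  by apply: filter_forall => j; have /cvgrPdist_le := fl j; apply.
apply: filterS => x fx; apply: norm_le_coord => [|j]; first exact: ltW.
by rewrite !mxE.
Qed.

Lemma cvg_dot {I : Type} (G : set_system I) {FG : Filter G} (f g : I -> V) (a b : V) :
  f @ G --> a -> g @ G --> b -> dot (f x) (g x) @[x --> G] --> dot a b.
Proof.
move=> fa gb; apply: cvg_big => [|j _]; first exact: add_continuous.
have coord_cvg (h : I -> V) (c : V) : h @ G --> c -> h x 0 j @[x --> G] --> c 0 j.
  move=> hc; apply: (@cvg_comp _ _ _ h (fun u : V => u 0 j) _ _ _ hc).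
  exact: coord_continuous.
by apply: cvgM; exact: coord_cvg.
Qed.

Lemma cvg_enorm {I : Type} (G : set_system I) {FG : Filter G} (f : I -> V) (a : V) :
  f @ G --> a -> enorm (f x) @[x --> G] --> enorm a.
Proof.
move=> fa; apply: (@cvg_comp _ _ _ (fun x => dot (f x) (f x)) Num.sqrt).
  exact: (cvg_dot fa fa).
exact: sqrt_continuous.
Qed.

Lemma continuous_dist x : continuous (fun z : V => enorm (x - z)).
Proof.
move=> z; have c : (fun y : V => x - y) @ z --> x - z.
  exact (@cvgB R V _ (nbhs z) _ (fun=> x) id x z (cvg_cst x) cvg_id).
exact: (cvg_enorm c).
Qed.

Lemma projP K x : compact K -> K !=set0 ->
  K (proj K x) /\ forall z, K z -> enorm (x - proj K x) <= enorm (x - z).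
Proof.
move=> cK K0; apply: (@getPex _ [set y | K y /\ forall z, K z -> _]).
have [|p pK pmin] := @EVT_min_rV R d (fun z => enorm (x - z)) K K0 cK.
  exact/continuous_subspaceT/continuous_dist.
exists p; split=> [|z Kz]; first exact: set_mem.
by apply: pmin; exact: mem_set.
Qed.

(** Moving p = proj K x towards z inside K cannot decrease the distance to x,
    so the derivative at t = 0 of |x - p - t (z - p)|^2, namely
    -2 (x - p).(z - p), is nonnegative. *)
Lemma proj_variational K x z : compact K -> convex_set K -> K z ->
  dot (x - proj K x) (z - proj K x) <= 0.
Proof.
move=> cK convK Kz.
have [Kp pmin] := @projP K x cK (ex_intro _ z Kz).
set p := proj K x in Kp pmin *; rewrite leNgt; apply/negP.
set q := x - p; set s := z - p; set a := dot q s => a0.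
pose b := dot s s; have b0 : 0 <= b by exact: dot_ge0.
have ab0 : 0 < a + b by rewrite ltr_pwDl.
(* any t in ]0, 1] with t * b < 2 * a moves p closer to x *)
pose t := a / (a + b).
have t0 : 0 < t by rewrite divr_gt0.
have t1 : t <= 1 by rewrite ler_pdivrMr// mul1r lerDl.
have := convK z p (Itv01 (ltW t0) t1) (mem_set Kz) (mem_set Kp).
move=> /set_mem /pmin; rewrite ler_sqrt ?dot_ge0//.
have -> : x - conv (Itv01 (ltW t0) t1) (z : convex_lmodType V) p = q - t *: s.
  rewrite /conv/= /isConvexSpace.conv/= /unstable.onem /q /s.
  by apply/rowP => j; rewrite !mxE; ring.
rewrite -/q; clearbody q s.
rewrite !(dotBl, dotBr, dotZl, dotZr) (dotC s) -/a -/b.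
have tab : t * (a + b) = a by rewrite divfK// gt_eqF.
have ta : 0 < t * a by rewrite mulr_gt0.
by nra.
Qed.

(** Adding the variational inequalities at x and at y gives
    |p - q|^2 <= (x - y).(p - q); expanding |(x - y) - (p - q)|^2 >= 0 then
    replaces the Cauchy-Schwarz inequality. *)
Lemma proj_nonexpansive K x y : compact K -> convex_set K -> K !=set0 ->
  enorm (proj K x - proj K y) <= enorm (x - y).
Proof.
move=> cK convK K0; have [Kp _] := projP x cK K0; have [Kq _] := projP y cK K0.
rewrite ler_sqrt ?dot_ge0//.
have := proj_variational x cK convK Kq; have := proj_variational y cK convK Kp.
set p := proj K x; set q := proj K y => pq qp.
have := dot_ge0 ((x - y) - (p - q)).
move: pq qp; rewrite !(dotBl, dotBr) (dotC y x) (dotC p x) (dotC p y) (dotC q x).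
by rewrite (dotC q y) (dotC q p); lra.
Qed.

Lemma proj_continuous K : compact K -> convex_set K -> K !=set0 ->
  continuous (proj K).
Proof.
move=> cK convK K0 x; apply: (@cvg_row _ (nbhs x)) => j; apply/cvgrPdist_lt => e e0.
have E0 : enorm (x - x) = 0.
  by rewrite subrr /enorm -(scale0r (0 : V)) dotZl mul0r sqrtr0.
have /cvgrPdist_lt /(_ e e0) := @continuous_dist x x.
rewrite E0; apply: filterS => y.
rewrite sub0r normrN ger0_norm ?sqrtr_ge0//; apply: le_lt_trans.
apply: le_trans (proj_nonexpansive x y cK convK K0).
by have := coord_le_enorm (proj K x - proj K y) j; rewrite !mxE.
Qed.

End euclidean_space.

(** * Elementary exponential bounds *)

Section exponential_bounds.
Context {R : realType}.
Implicit Types (y s a : R).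

(** The inequality 1 - y <= e^-y, multiplied by e^y. *)
Lemma expR_sub1_le y : expR y - 1 <= y * expR y.
Proof.
have := expR_ge1Dx (- y); rewrite expRN => le1.
rewrite -(ler_pM2r (x := (expR y)^-1)) ?invr_gt0 ?expR_gt0//.
by rewrite mulrBl mulfK ?divff ?gt_eqF ?expR_gt0// mul1r; lra.
Qed.

Lemma normr_expR_sub1 y : `|expR y - 1| <= `|y| * expR `|y|.
Proof.
have := expR_sub1_le y; have := expR_ge1Dx y.
have [y0 h1 h2|y0 h1 h2] := leP 0 y.
  by rewrite (ger0_norm y0) ger0_norm//; lra.
rewrite (ltr0_norm y0) ler0_norm; last by rewrite subr_le0 -expR0 ler_expR ltW.
have : 1 <= expR (- y) by rewrite -expR0 ler_expR oppr_ge0 ltW.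
by nra.
Qed.

Lemma normr_expR_taylor1 y : `|expR y - 1 - y| <= y ^+ 2 * expR `|y|.
Proof.
have h1 := expR_ge1Dx y; rewrite ger0_norm; last by lra.
apply: (@le_trans _ _ (y * (expR y - 1))); first by have := expR_sub1_le y; lra.
rewrite (le_trans (ler_norm _))// normrM -(real_normK (num_real y)) expr2 -mulrA.
by rewrite ler_wpM2l// normr_expR_sub1.
Qed.

(** Absorbs the polynomial weights created by differentiation into half of the
    exponential weight: it is the square of
    1 + s <= (1 + 4 / a) (1 + a s / 4) <= (1 + 4 / a) exp(a s / 4). *)
Lemma sqr_1D_le_expR a s : 0 < a -> 0 <= s ->
  (1 + s) ^+ 2 <= (1 + 4 / a) ^+ 2 * expR (a / 2 * s).
Proof.
move=> a0 s0; have -> : a / 2 * s = 2%:R * (a * s / 4) by field.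
rewrite expRM_natl -exprMn.
have h := expR_ge1Dx (a * s / 4).
have as0 : 0 <= a * s by rewrite mulr_ge0// ltW.
have a40 : 0 < 4 / a by rewrite divr_gt0.
rewrite ler_sqr ?nnegrE; last 2 first.
- by lra.
- by rewrite mulr_ge0 ?expR_ge0//; lra.
apply: (@le_trans _ _ ((1 + 4 / a) * (1 + a * s / 4))); last first.
  by rewrite ler_wpM2l//; lra.
have E : 4 / a * (a * s / 4) = s by field; rewrite gt_eqF.
by rewrite mulrDl mul1r mulrDr E; lra.
Qed.

End exponential_bounds.

Section l1_norm.
Context {R : realType} {d : nat}.
Local Notation V := 'rV[R]_d.
Implicit Types (x h : V).

Definition norm1 x : R := \sum_(j < d) `|x 0 j|.

Lemma norm1_ge0 x : 0 <= norm1 x.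
Proof. exact: sumr_ge0. Qed.

Lemma coord_le_norm1 x j : `|x 0 j| <= norm1 x.
Proof. by rewrite /norm1 (bigD1 j)//= lerDl sumr_ge0. Qed.

Lemma normr_dot h x : `|dot h x| <= `|h| * norm1 x.
Proof.
rewrite (le_trans (ler_norm_sum _ _ _))// mulr_sumr ler_sum// => j _.
by rewrite normrM ler_wpM2r// coord_le_norm.
Qed.

(** The norm is at most d times its largest coordinate, up to sign, so one term
    of the sum already dominates the left-hand side. *)
Lemma expR_norm1_le x c : (0 < d)%N -> 0 < c ->
  expR (c / d%:R * norm1 x) <=
  \sum_(j < d) (expR (c * x 0 j) + expR (- c * x 0 j)).
Proof.
move=> d0 c0; pose j0 := Ordinal d0.
have [j _ jmax] := arg_maxP (fun k => `|x 0 k|) (erefl : xpredT j0).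
have xj : c / d%:R * norm1 x <= c * `|x 0 j|.
  rewrite -mulrA ler_pM2l// ler_pdivrMl ?ltr0n// mulr_natl.
  rewrite -[X in _ *+ X]card_ord -sumr_const ler_sum// => k _; exact: jmax.
rewrite -ler_expR in xj; apply: (le_trans xj).
rewrite (bigD1 j)//=.
have rest : 0 <= \sum_(k < d | k != j) (expR (c * x 0 k) + expR (- c * x 0 k)).
  by apply: sumr_ge0 => k _; rewrite addr_ge0 ?expR_ge0.
have := expR_ge0 (c * x 0 j); have := expR_ge0 (- c * x 0 j).
by case: (ger0P (x 0 j)) => xj0; rewrite ?mulrN -?mulNr; lra.
Qed.

Lemma norm1_continuous : continuous norm1.
Proof.
move=> x; apply: (@cvg_big _ _ _ _ _ _ _ (nbhs x)) => [|j _]; first exact: add_continuous.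
apply: (@cvg_comp _ _ _ (fun u : V => u 0 j) Num.norm).
  exact: coord_continuous.
exact: norm_continuous.
Qed.

Lemma dot_continuous h : continuous (dot h).
Proof.
move=> x; apply: (cvg_dot (G := nbhs x) (f := cst h) (g := id)).
  exact: cvg_cst.
exact: cvg_id.
Qed.

Lemma continuous_borel (f : V -> R) : continuous f ->
  measurable_fun setT (f : borelV R d -> R).
Proof.
move=> /continuousP cf.
apply: (measurability _ (RGenOpens.measurableE R)).
move=> _ [_ [a [b ->]] <-]; rewrite setTI; apply: sub_sigma_algebra.
by apply: cf; exact: interval_open.
Qed.

End l1_norm.

(** * Exponential moments around an interior point of their domain *)

Section exponential_moments.
Context {R : realType} {d : nat} {dO : measure_display} {Omega : measurableType dO}.
Variables (P : probability Omega R) (X : Omega -> 'rV[R]_d).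
Hypothesis mX : measurable_fun setT (X : Omega -> borelV R d).
Hypothesis d_gt0 : (0 < d)%N.
Local Notation V := 'rV[R]_d.
Implicit Types (theta h : V) (phi : V -> R) (a : R).

Lemma measurable_comp_continuous phi :
  continuous phi -> measurable_fun setT (phi \o X).
Proof. by move=> /continuous_borel mphi; exact: measurableT_comp mphi mX. Qed.

Definition mgf_dom : set V := [set theta | (kappa P X theta < +oo)%E].

Definition exp_moment phi theta : R :=
  \int[P]_w (phi (X w) * expR (dot theta (X w))).

Lemma measurable_tilted phi theta : continuous phi ->
  measurable_fun setT (fun w => phi (X w) * expR (dot theta (X w))).
Proof.
move=> cphi; apply: measurable_funM; first exact: measurable_comp_continuous.
apply: measurableT_comp; first exact: measurable_expR.
exact/measurable_comp_continuous/dot_continuous.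
Qed.

(** The extended logarithm takes the value +oo only at +oo, so kappa < +oo is an
    integrability statement. *)
Lemma mgf_domP theta : mgf_dom theta <->
  P.-integrable setT (fun w => (expR (dot theta (X w)))%:E).
Proof.
have mE : measurable_fun setT (fun w => (expR (dot theta (X w)))%:E).
  apply/measurable_EFinP/measurableT_comp.
    exact: measurable_expR.
  exact/measurable_comp_continuous/dot_continuous.
have absE : (\int[P]_w `|(expR (dot theta (X w)))%:E| =
    \int[P]_w (expR (dot theta (X w)))%:E)%E.
  by apply: eq_integral => w _; rewrite /= ger0_norm ?expR_ge0.
rewrite /mgf_dom /kappa /= unlock; split=> [k|/integrableP[_]].
  apply/integrableP; split=> //; rewrite absE.
  by move: k; case: (integral _ _ _) => //= r _; rewrite ltry.
rewrite absE; case: (integral _ _ _) => //= r _.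
by case: ifP => // _; rewrite ltry.
Qed.

(** The two observables of interest, the constant 1 and the coordinates, give M
    and its partial derivatives; the constant 1 in the bound accommodates both. *)
Definition linear_growth phi := continuous phi /\ forall x, `|phi x| <= 1 + norm1 x.

Lemma linear_growth_cst1 : linear_growth (cst 1).
Proof.
split=> [|x]; first exact: cst_continuous.
by rewrite normr1 lerDl norm1_ge0.
Qed.

Lemma linear_growth_coord j : linear_growth (fun x => x 0 j).
Proof.
split=> [|x]; first exact: coord_continuous.
by rewrite ler_wpDl// coord_le_norm1.
Qed.

Definition tilted_envelope theta a w :=
  expR (dot theta (X w)) * expR (a * norm1 (X w)).

(** The ball around theta contains the 2 d points theta +- c e_j, and the sum of
    the exponentials at these points dominates exp(theta.x + (c / d) |x|_1). *)
Lemma interior_envelope theta : mgf_dom° theta -> exists2 a, 0 < a &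
  P.-integrable setT (EFin \o tilted_envelope theta a).
Proof.
move=> /nbhs_ballP[e /= e0 eD]; pose c := e / 2.
have c0 : 0 < c by rewrite divr_gt0.
have cD t j : `|t| <= c -> mgf_dom (theta + t *: delta_mx 0 j).
  move=> tc; apply: eD; rewrite -ball_normE /= opprD addrA subrr add0r normrN.
  apply: (@le_lt_trans _ _ c); last by rewrite /c; lra.
  apply: norm_le_coord => [|k]; first exact: ltW.
  rewrite !mxE normrM (le_trans _ tc)// ler_piMr//.
  by case: (_ && _); rewrite ?normr1 ?normr0.
exists (c / d%:R); first by rewrite divr_gt0// ltr0n.
pose g w := \sum_(j < d) (expR (dot (theta + c *: delta_mx 0 j) (X w)) +
                          expR (dot (theta + (- c) *: delta_mx 0 j) (X w))).
apply: (@le_integrable _ _ _ _ _ _ _ (EFin \o g)) => //.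
- apply/measurable_EFinP/measurable_funM.
    apply: measurableT_comp; first exact: measurable_expR.
    exact/measurable_comp_continuous/dot_continuous.
  apply: measurableT_comp; first exact: measurable_expR.
  apply: measurable_funM; first exact: measurable_cst.
  exact/measurable_comp_continuous/norm1_continuous.
- move=> w _; rewrite /= lee_fin !ger0_norm ?mulr_ge0 ?expR_ge0//; last first.
    by apply: sumr_ge0 => j _; rewrite addr_ge0 ?expR_ge0.
  rewrite /tilted_envelope.
  apply: le_trans (ler_wpM2l (expR_ge0 _) (expR_norm1_le _ d_gt0 c0)) _.
  rewrite mulr_sumr ler_sum// => j _.
  by rewrite !dotDl !dotZl !dot_delta !expRD mulrDr.
- rewrite (_ : EFin \o g = fun w => (\sum_(j < d)
     ((expR (dot (theta + c *: delta_mx 0 j) (X w)))%:E +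
      (expR (dot (theta + (- c) *: delta_mx 0 j) (X w)))%:E))%E); last first.
    by apply/funext => w; rewrite /g /= sumEFin.
  apply: integrable_sum => // j _; apply: integrableD => //; apply/mgf_domP/cD.
    by rewrite ger0_norm// ltW.
  by rewrite normrN ger0_norm// ltW.
Qed.

Section envelope.
Variables (theta : V) (a : R).
Hypothesis a_gt0 : 0 < a.
Hypothesis env_int : P.-integrable setT (EFin \o tilted_envelope theta a).

Let B := (1 + 4 / a) ^+ 2.
Let C := B * \int[P]_w tilted_envelope theta a w.

(** The envelope is split in two halves: one pays for the quadratic weight, the
    other for the shift of theta by h. *)
Lemma envelope_quadratic h w : `|h| <= a / 2 ->
  (1 + norm1 (X w)) ^+ 2 * expR `|dot h (X w)| * expR (dot theta (X w)) <=
  B * tilted_envelope theta a w.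
Proof.
move=> ha; have s0 := norm1_ge0 (X w).
rewrite /tilted_envelope [X in B * X]mulrC mulrA ler_wpM2r ?expR_ge0//.
have -> : a * norm1 (X w) = a / 2 * norm1 (X w) + a / 2 * norm1 (X w) by field.
rewrite expRD mulrA ler_pM ?expR_ge0 ?sqr_ge0//; first exact: sqr_1D_le_expR.
by rewrite ler_expR (le_trans (normr_dot _ _))// ler_wpM2r.
Qed.

Lemma tilted_integrable phi h : linear_growth phi -> `|h| <= a / 2 ->
  P.-integrable setT
    (EFin \o (fun w => phi (X w) * expR (dot (theta + h) (X w)))).
Proof.
move=> [cphi phile] ha.
apply: (@le_integrable _ _ _ _ _ _ _ (EFin \o (fun w => B * tilted_envelope theta a w))) => //.
- exact/measurable_EFinP/measurable_tilted.
- move=> w _; rewrite /= lee_fin [leRHS]ger0_norm; last first.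
    by rewrite mulr_ge0 ?sqr_ge0// mulr_ge0 ?expR_ge0.
  apply: le_trans (envelope_quadratic w ha).
  rewrite normrM (ger0_norm (expR_ge0 _)) dotDl addrC expRD mulrA.
  rewrite ler_wpM2r ?expR_ge0// ler_pM ?expR_ge0//; last by rewrite ler_expR ler_norm.
  apply: le_trans (phile _) _; have := norm1_ge0 (X w).
  by rewrite expr2 => s0; rewrite ler_peMr; lra.
- by have := integrableZl measurableT B env_int; apply: eq_integrable => // w _.
Qed.

Lemma Rintegral_dist_le (f g : Omega -> R) r :
  P.-integrable setT (EFin \o f) -> P.-integrable setT (EFin \o g) ->
  (forall w, `|f w - g w| <= r * (B * tilted_envelope theta a w)) ->
  `|\int[P]_w f w - \int[P]_w g w| <= r * C.
Proof.
move=> If Ig fg; have Ifg : P.-integrable setT (EFin \o (fun w => f w - g w)).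
  by have := integrableB measurableT If Ig; apply: eq_integrable => // w _.
have Ienv k : P.-integrable setT (EFin \o (fun w => k * tilted_envelope theta a w)).
  by have := integrableZl measurableT k env_int; apply: eq_integrable => // w _.
rewrite -RintegralB// (le_trans (le_normr_Rintegral _ _))//.
rewrite /C mulrA -RintegralZl//; apply: le_Rintegral => //.
  by have := integrable_abse Ifg; apply: eq_integrable => // w _.
by move=> w _; rewrite -mulrA.
Qed.

(** Pointwise, |phi(x)| |e^(h.x) - 1| <= |h| (1 + |x|_1)^2 e^|h.x|. *)
Lemma exp_moment_lipschitz phi h : linear_growth phi -> `|h| <= a / 2 ->
  `|exp_moment phi (theta + h) - exp_moment phi theta| <= `|h| * C.
Proof.
move=> dphi ha; apply: Rintegral_dist_le; first exact: tilted_integrable.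
  have := tilted_integrable (h := 0) dphi; rewrite addr0; apply.
  by rewrite normr0 divr_ge0// ltW.
move=> w; have s0 := norm1_ge0 (X w).
apply: le_trans (ler_wpM2l (normr_ge0 h) (envelope_quadratic w ha)).
rewrite -mulrBr normrM dotDl expRD -[X in _ - X]mulr1 -mulrBr normrM.
rewrite (ger0_norm (expR_ge0 _)) [X in _ * X]mulrC !mulrA ler_wpM2r ?expR_ge0//.
apply: le_trans (ler_wpM2l (normr_ge0 _) (normr_expR_sub1 _)) _.
rewrite mulrA ler_wpM2r ?expR_ge0// [leRHS]mulrC ler_pM//.
  by case: dphi.
by rewrite (le_trans (normr_dot _ _))// ler_wpM2l//; lra.
Qed.

(** Along theta + t e_j the integrand is e^(theta.x) e^(t x_j); the remainder
    e^(t x_j) - 1 - t x_j of the second factor is bounded by t^2 (1 + |x|_1)^2 e^|t x_j|. *)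
Lemma mgf_taylor j t : `|t| <= a / 2 ->
  `|exp_moment (cst 1) (theta + t *: delta_mx 0 j) -
    (exp_moment (cst 1) theta + t * exp_moment (fun x => x 0 j) theta)|
  <= t ^+ 2 * C.
Proof.
move=> ta.
have th : `|t *: delta_mx 0 j : V| <= a / 2.
  apply: (le_trans _ ta); apply: norm_le_coord => // k.
  by rewrite !mxE normrM ler_piMr//; case: (_ && _); rewrite ?normr1 ?normr0.
have at0 phi : linear_growth phi -> P.-integrable setT
    (EFin \o (fun w => phi (X w) * expR (dot theta (X w)))).
  move=> dphi; have := tilted_integrable (h := 0) dphi; rewrite addr0; apply.
  by rewrite normr0 divr_ge0// ltW.
have Ij := at0 _ (linear_growth_coord j); have I1 := at0 _ linear_growth_cst1.
have Itj : P.-integrable setT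
    (EFin \o (fun w => t * (X w 0 j * expR (dot theta (X w))))).
  by have := integrableZl measurableT t Ij; apply: eq_integrable => // w _.
rewrite /exp_moment -RintegralZl// -RintegralD//; apply: Rintegral_dist_le.
- exact: tilted_integrable linear_growth_cst1 th.
- by have := integrableD measurableT I1 Itj; apply: eq_integrable => // w _.
move=> w; have s0 := norm1_ge0 (X w).
apply: le_trans (ler_wpM2l (sqr_ge0 t) (envelope_quadratic w th)).
rewrite dotDl dotZl dot_delta expRD /cst !mul1r mulrA.
set x := X w 0 j; set E := expR (dot _ _).
have -> : E * expR (t * x) - (E + t * x * E) = E * (expR (t * x) - 1 - t * x) by ring.
rewrite normrM (ger0_norm (expR_ge0 _)) [leLHS]mulrC !mulrA ler_wpM2r ?expR_ge0//.
apply: le_trans (normr_expR_taylor1 _) _.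
rewrite ler_wpM2r ?expR_ge0// exprMn -[leRHS]mulrA -expr2 ler_wpM2l ?sqr_ge0//.
rewrite -(real_normK (num_real x)) ler_sqr ?nnegrE//; last by lra.
by rewrite (le_trans (coord_le_norm1 _ _))// lerDr.
Qed.

End envelope.

End exponential_moments.

(** * Smoothness of the logarithm of the moment generating function *)

(** Reduces a directional derivative to a one-variable one, for which the chain
    rule with the logarithm is available. *)
Lemma derive_along_line {R : numFieldType} {V W : normedModType R}
    (f : V -> W) (x v : V) :
  'D_v f x = 'D_1 (fun t : R => f (x + t *: v)) 0.
Proof.
rewrite /derive; set g1 := fun h : R => h^-1 *: _; set g2 := fun h : R => h^-1 *: _.
suff -> : g1 = g2 by [].
apply/funext => h; rewrite /g1 /g2 /= scale0r !addr0 [_ *: 1]mulr1.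
by rewrite (addrC x).
Qed.

Section log_mgf.
Context {R : realType} {d : nat} {dO : measure_display} {Omega : measurableType dO}.
Variables (P : probability Omega R) (X : Omega -> 'rV[R]_d).
Hypothesis mX : measurable_fun setT (X : Omega -> borelV R d).
Hypothesis d_gt0 : (0 < d)%N.
Local Notation V := 'rV[R]_d.
Implicit Types (theta h : V) (phi : V -> R) (a : R).
Local Notation mgf := (exp_moment P X (cst 1)).
Local Notation mgf1 j := (exp_moment P X (fun x : V => x 0 j)).
Local Notation D := (mgf_dom P X).

Lemma exp_moment_continuous phi theta : linear_growth phi -> D° theta ->
  {for theta, continuous (exp_moment P X phi)}.
Proof.
move=> dphi /(interior_envelope mX d_gt0)[a a0 env].
have := exp_moment_lipschitz mX a0 env dphi; set C := ((1 + _) ^+ 2 * _)%R => lip.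
apply/(@cvgrPdist_le _ _ _ (nbhs theta)) => e e0.
have C1 : 0 < `|C| + 1 by rewrite ltr_wpDl.
pose r := Num.min (a / 2) (e / (`|C| + 1)).
have r0 : 0 < r by rewrite lt_min !divr_gt0.
near=> y; have yr : `|y - theta| <= r.
  by rewrite distrC; near: y; exact: (@cvgr_dist_le _ _ _ (nbhs theta) _ id).
move: yr; rewrite le_min => /andP[ya ye].
have E : theta + (y - theta) = y by rewrite addrC subrK.
rewrite distrC; have := lip _ ya; rewrite E => /le_trans; apply.
apply: (@le_trans _ _ (`|y - theta| * (`|C| + 1))).
  by rewrite ler_wpM2l// ler_wpDr// ler_norm.
by rewrite -ler_pdivlMr.
Unshelve. all: by end_near. Qed.

(** A nonnegative function with zero integral vanishes almost everywhere, which
    an exponential does nowhere. *)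
Lemma mgf_gt0 theta : D theta -> 0 < mgf theta.
Proof.
move=> /(mgf_domP P mX) Ie.
have I1 : P.-integrable setT (EFin \o (fun w => cst 1 (X w) * expR (dot theta (X w)))).
  by apply: eq_integrable Ie => // w _; rewrite /= mul1r.
have m0 : 0 <= mgf theta.
  by apply: Rintegral_ge0 => w _; rewrite mul1r expR_ge0.
rewrite lt_neqAle m0 andbT; apply/negP => /eqP/esym E0.
have : (\int[P]_w `|(expR (dot theta (X w)))%:E| = 0)%E.
  rewrite -(_ : (mgf theta)%:E = 0%E); last by rewrite E0.
  rewrite /exp_moment /Rintegral fineK; last exact: integrable_fin_num.
  by apply: eq_integral => w _; rewrite /= mul1r ger0_norm// expR_ge0.
move/(ae_eq_integral_abs P measurableT).
case; first by case/integrableP: Ie.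
move=> N [mN PN0 sN].
have NT : N = setT.
  rewrite -subTset => w _; apply: sN => /= /(_ I) [] /eqP.
  by rewrite gt_eqF// expR_gt0.
have : (0 = 1 :> \bar R)%E.
  by rewrite -PN0 NT; exact: probability_setT.
by case=> /eqP; rewrite eq_sym oner_eq0.
Qed.

Lemma kappa_ln theta : D theta -> fine (kappa P X theta) = ln (mgf theta).
Proof.
move=> Dt; have /(mgf_domP P mX) Ie := Dt.
have -> : kappa P X theta = lne (mgf theta)%:E.
  rewrite /kappa unlock /exp_moment /Rintegral fineK.
    by congr lne; apply: eq_integral => w _; rewrite /= mul1r.
  apply: integrable_fin_num => //.
  by apply: eq_integrable Ie => // w _; rewrite /= mul1r.
by rewrite lne_EFin// mgf_gt0.
Qed.

Lemma is_derive_mgf theta j : D° theta ->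
  is_derive (0 : R) (1 : R) (fun t : R => mgf (theta + t *: delta_mx 0 j)) (mgf1 j theta).
Proof.
move=> /(interior_envelope mX d_gt0)[a a0 env].
have := mgf_taylor mX a0 env j; set C := ((1 + _) ^+ 2 * _)%R => taylor.
suff H : h^-1 *: (((fun t : R => mgf (theta + t *: delta_mx 0 j)) \o shift 0) (h *: (1 : R))
    - mgf (theta + 0 *: delta_mx 0 j)) @[h --> (0 : R)^'] --> mgf1 j theta.
  by split; [apply/cvg_ex; exists (mgf1 j theta)|exact: cvg_lim H].
apply/cvgrPdist_le => e e0.
have C1 : 0 < `|C| + 1 by rewrite ltr_wpDl.
pose r := Num.min (a / 2) (e / (`|C| + 1)).
have r0 : 0 < r by rewrite lt_min !divr_gt0.
near=> h.
have h0 : h != 0 by near: h; exact: nbhs_dnbhs_neq.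
have hr : `|h| <= r.
  by near: h; exact: dnbhs0_le.
move: hr; rewrite le_min => /andP[ha he].
have := taylor _ ha; rewrite scale0r addr0 /= addr0.
rewrite [h *: 1]mulr1.
set m0 := mgf theta; set mh := mgf _; set m1 := mgf1 j theta => le1.
have -> : m1 - h^-1 *: (mh - m0) = - (h^-1 * (mh - (m0 + h * m1))).
  by rewrite /GRing.scale/=; field.
rewrite normrN normrM normfV ler_pdivrMl ?normr_gt0//.
apply: (le_trans le1); rewrite -(real_normK (num_real h)) expr2 -mulrA.
rewrite ler_wpM2l//; apply: (@le_trans _ _ (`|h| * (`|C| + 1))).
  by rewrite ler_wpM2l// ler_wpDr// ler_norm.
by rewrite -ler_pdivlMr.
Unshelve. all: by end_near. Qed.

Lemma grad_kappa theta : D° theta ->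
  grad (fine \o kappa P X) theta = \row_j (mgf1 j theta / mgf theta).
Proof.
move=> Dt; apply/rowP => j; rewrite !mxE.
have dm := is_derive_mgf j Dt.
have m0 : 0 < mgf (theta + 0 *: delta_mx 0 j).
  by rewrite scale0r addr0 mgf_gt0//; exact: interior_subset.
rewrite [RHS]mulrC.
have -> : mgf theta = mgf (theta + 0 *: delta_mx 0 j) by rewrite scale0r addr0.
have [_ <-] := is_derive1_comp (is_derive1_ln m0) dm.
have -> : 'D_(delta_mx 0 j) (fine \o kappa P X) theta =
    'D_(delta_mx 0 j) (@ln R \o mgf) theta.
  apply: near_eq_derive; apply: filterS (open_nbhs_nbhs (conj (open_interior D) Dt)) => y Dy.
  by rewrite /= kappa_ln//; exact: interior_subset.
exact: derive_along_line.
Qed.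

Lemma kappa_continuous theta : D° theta ->
  {for theta, continuous (fine \o kappa P X)}.
Proof.
move=> Dt; have c : (@ln R \o mgf) y @[y --> theta] --> ln (mgf theta).
  apply: (@cvg_comp _ _ _ mgf (@ln R)).
    exact: (exp_moment_continuous linear_growth_cst1 Dt).
  by apply: continuous_ln; apply: mgf_gt0; exact: interior_subset.
rewrite /prop_for /continuous_at /= kappa_ln; last exact: interior_subset.
apply: cvg_trans c; apply: (@near_eq_cvg _ _ (nbhs theta)).
apply: filterS (open_nbhs_nbhs (conj (open_interior D) Dt)) => y Dy.
by rewrite /= kappa_ln//; exact: interior_subset.
Qed.

Lemma grad_kappa_continuous theta : D° theta ->
  {for theta, continuous (grad (fine \o kappa P X))}.
Proof.
move=> Dt; rewrite /prop_for /continuous_at grad_kappa//.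
apply: (@cvg_row _ _ _ (nbhs theta)) => j; rewrite mxE.
have c : mgf1 j y / mgf y @[y --> theta] --> mgf1 j theta / mgf theta.
  apply: (@cvgM _ _ (nbhs theta)).
    exact: (exp_moment_continuous (linear_growth_coord j) Dt).
  apply: (@cvgV _ _ (nbhs theta)); first by rewrite gt_eqF// mgf_gt0//; exact: interior_subset.
  exact: (exp_moment_continuous linear_growth_cst1 Dt).
apply: cvg_trans c; apply: (@near_eq_cvg _ _ (nbhs theta)).
apply: filterS (open_nbhs_nbhs (conj (open_interior D) Dt)) => y Dy.
by rewrite /= grad_kappa// mxE.
Qed.

End log_mgf.

(** * Almost sure continuity as a property of the law *)

Section continuity_points.
Context {R : realType} {d : nat}.
Local Notation V := 'rV[R]_d.
Implicit Types f : V -> R.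

Definition continuity_points f : set V := [set x | {for x, continuous f}].

(** Continuity at x means that the oscillation of f near x is arbitrarily small;
    having small oscillation on a neighbourhood is an open condition, so the
    right-hand side exhibits a G_delta set. *)
Lemma continuity_pointsE f : continuity_points f =
  \bigcap_(n : nat) \bigcup_(U in [set U : set V | open U /\
     forall y z, U y -> U z -> `|f y - f z| < n.+1%:R^-1]) U.
Proof.
apply/seteqP; split=> [x cx n _|x osc].
  have e0 : 0 < n.+1%:R^-1 / 2 :> R by rewrite divr_gt0// invr_gt0.
  have /cvgrPdist_lt /(_ _ e0) := cx.
  rewrite near_simpl => /nbhs_interior near_x.
  exists [set y | `|f x - f y| < n.+1%:R^-1 / 2]°; last exact: nbhs_singleton.
  split=> [|y z /interior_subset /= fy /interior_subset /= fz].
    exact: open_interior.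
  have -> : f y - f z = (f x - f z) - (f x - f y) by ring.
  by rewrite (le_lt_trans (ler_normB _ _))// [ltRHS]splitr ltrD.
apply/(@cvgrPdist_lt _ _ _ (nbhs x)) => e e0.
have [n ne] := ltr_add_invr (y := 0) (x := e) e0.
have [U [oU Uosc] Ux] := osc n I.
apply: filterS (open_nbhs_nbhs (conj oU Ux)) => y Uy.
by apply: lt_trans (Uosc x y Ux Uy) _; move: ne; rewrite add0r.
Qed.

Lemma measurable_continuity_points f :
  measurable (continuity_points f : set (borelV R d)).
Proof.
rewrite continuity_pointsE; apply: bigcapT_measurable => n.
by apply: sub_sigma_algebra; apply: bigcup_open => U [].
Qed.

Lemma ae_continuity_transfer f
    {d1 d2 : measure_display} {O1 : measurableType d1} {O2 : measurableType d2}
    (P1 : probability O1 R) (P2 : probability O2 R)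
    (X1 : O1 -> V) (X2 : O2 -> V) :
  measurable_fun setT (X1 : O1 -> borelV R d) ->
  measurable_fun setT (X2 : O2 -> borelV R d) ->
  (forall B : set (borelV R d), measurable B -> P1 (X1 @^-1` B) = P2 (X2 @^-1` B)) ->
  {ae P1, forall w, {for X1 w, continuous f}} ->
  {ae P2, forall w, {for X2 w, continuous f}}.
Proof.
move=> mX1 mX2 law cf1.
have mB : measurable (~` continuity_points f : set (borelV R d)).
  by apply: measurableC; exact: measurable_continuity_points.
have mpre dO (O : measurableType dO) (X : O -> V) :
    measurable_fun setT (X : O -> borelV R d) -> measurable (X @^-1` (~` continuity_points f)).
  by move=> mX; rewrite -[X in measurable X]setTI; exact: mX.
have P1B : P1 (X1 @^-1` (~` continuity_points f)) = 0%E.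
  by apply/negligibleP; [exact: (mpre _ _ _ mX1)|exact: cf1].
apply/negligibleP; first exact: (mpre _ _ _ mX2).
exact: etrans (esym (law _ mB)) P1B.
Qed.

End continuity_points.

(** * Stability of the projected recursion *)

Section robbins_monro.
Context {R : realType} {d : nat}.
Local Notation V := 'rV[R]_d.

Lemma cvg_Hi {I : Type} (G : set_system I) {FG : Filter G} (T : R)
    (k : V -> \bar R) (f : V -> R) (th x : I -> V) (th0 x0 : V) :
  {for th0, continuous (fine \o k)} ->
  {for th0, continuous (grad (fine \o k))} ->
  {for x0, continuous f} ->
  th @ G --> th0 -> x @ G --> x0 ->
  Hi T k f (th i) (x i) @[i --> G] --> Hi T k f th0 x0.
Proof.
move=> ck cgk cf cth cx; rewrite /Hi.
have ckth : fine (k (th i)) @[i --> G] --> fine (k th0) by exact: cvg_comp cth ck.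
have cgth : grad (fine \o k) (th i) @[i --> G] --> grad (fine \o k) th0.
  exact: cvg_comp cth cgk.
have cfx : f (x i) @[i --> G] --> f x0 by exact: cvg_comp cx cf.
have cexp : expR (- dot (th i) (x i) + T * fine (k (th i))) @[i --> G] -->
    expR (- dot th0 x0 + T * fine (k th0)).
  apply: (@cvg_comp _ _ _ (fun i => - dot (th i) (x i) + T * fine (k (th i))) expR);
    last exact: continuous_expR.
  exact (cvgD (cvgN (cvg_dot cth cx)) (cvgM (cvg_cst T) ckth)).
exact (cvgZ (cvgM cfx cexp) (cvgB (cvgZ (cvg_cst T) cgth) cx)).
Qed.

Lemma robbins_monro_in (K : set V) (H : V -> V -> V) step theta0 x n :
  compact K -> K theta0 -> K (robbins_monro K H step theta0 x n).
Proof.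
move=> cK K0; case: n => //= n.
by have [] := projP (robbins_monro K H step theta0 x n -
   step n.+1 *: H (robbins_monro K H step theta0 x n) (x n.+1)) cK (ex_intro _ theta0 K0).
Qed.

(** The hypothesis only asks for continuity of H in theta at the points of K:
    the limiting iterates never leave K. *)
Lemma cvg_robbins_monro {I : Type} (G : set_system I) {FG : Filter G}
    (K : set V) (H : V -> V -> V) step theta0 (y : I -> nat -> V) (x : nat -> V) n :
  compact K -> convex_set K -> K theta0 ->
  (forall m th th0, (0 < m <= n)%N -> K th0 -> th @ G --> th0 ->
     H (th i) (y i m) @[i --> G] --> H th0 (x m)) ->
  robbins_monro K H step theta0 (y i) n @[i --> G] -->
  robbins_monro K H step theta0 x n.
Proof.
move=> cK convK K0; elim: n => [|n IHn] cH /=; first exact: cvg_cst.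
have c1 : robbins_monro K H step theta0 (y i) n @[i --> G] -->
    robbins_monro K H step theta0 x n.
  apply: IHn => m th th0 /andP[m0 mn]; apply: cH.
  by rewrite m0 leqW.
have cHn : H (robbins_monro K H step theta0 (y i) n) (y i n.+1) @[i --> G] -->
    H (robbins_monro K H step theta0 x n) (x n.+1).
  by apply: cH => //; [rewrite ltnSn|exact: robbins_monro_in].
apply: (@cvg_comp _ _ _ (fun i => robbins_monro K H step theta0 (y i) n -
    step n.+1 *: H (robbins_monro K H step theta0 (y i) n) (y i n.+1)) (proj K)).
  exact (cvgB c1 (cvgZ (cvg_cst (step n.+1)) cHn)).
by apply: proj_continuous => //; exists theta0.
Qed.

End robbins_monro.

Theorem theorem5p2 (R : realType) (d : nat) (hd : (1 <= d)%N) (T : R) (hT : 0 < T)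
  (d0 : measure_display) (Omega0 : measurableType d0) (P0 : probability Omega0 R)
  (L : R -> Omega0 -> 'rV[R]_d) (gamma : 'rV[R]_d)
  (nu : {measure set (borelV R d) -> \bar R})
  (hL : levy_process P0 L) (hLnu : pure_jump_triplet P0 L gamma nu)
  (i : nat) (hi : i = 1%N \/ i = 2%N)
  (F : 'rV[R]_d -> R) (Sigma : 'M[R]_d)
  (hF : i = 2%N -> forall x : 'rV[R]_d, differentiable F x)
  (hSigma : i = 2%N -> posdefmx Sigma /\
     ((sigma2 nu eps)^-1 *: Sigma_eps nu eps) @[eps --> 0^'+] --> Sigma)
  (* F_i is almost surely continuous at L_T *)
  (hFi : {ae P0, forall w, {for L T w, continuous (Fi i F Sigma)}})
  (dO : measure_display) (Omega : measurableType dO) (P : probability Omega R)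
  (LT : nat -> Omega -> 'rV[R]_d) (LTeps : R -> nat -> Omega -> 'rV[R]_d)
  (hcopies : iid_copies P0 (L T) (fun eps w => Leps gamma nu eps (L ^~ w) T)
               P LT LTeps)
  (step : nat -> R) (hstep : step_sequence step)
  (K : set 'rV[R]_d) (hKc : compact K) (hKconv : convex_set K) (hK0 : K 0)
  (hK : K `<=` Theta1 nu)
  (* the gradient of kappa in H_i is meaningful at the points of K *)
  (hKkappa : K `<=` [set theta | (kappa P0 (L 1%R) theta < +oo)%E]°)
  (theta0 : 'rV[R]_d) (htheta0 : K theta0) :
  let H := Hi T (kappa P0 (L 1)) (Fi i F Sigma) in
  let theta n w := robbins_monro K H step theta0 (fun m => LT m w) n in
  let thetaeps eps n w :=
    robbins_monro K H step theta0 (fun m => LTeps eps m w) n in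
  forall n : nat,
    {ae P, forall w, thetaeps eps n w @[eps --> 0^'+] --> theta n w}.
Proof.
move=> H theta thetaeps n.
have mL1 := levy_measurable hL (ler01 : (0 : R) <= 1).
have mLT := levy_measurable hL (ltW hT).
have [mcopies lcopies _ ccopies] := hcopies.
have cont_LT m : (0 < m)%N ->
    {ae P, forall w, {for LT m w, continuous (Fi i F Sigma)}}.
  move=> m0; apply: (ae_continuity_transfer mLT (mcopies m None m0 I) _ hFi).
  move=> B mB; have := lcopies m m0 [:: None] (fun=> B).
  have set1 (O : Type) (Y : option R -> O -> 'rV[R]_d) :
      \bigcap_(o in [set` [:: None]]) Y o @^-1` B = Y None @^-1` B.
    apply/seteqP; split=> [w /(_ None)|w YB o /=].
      by apply; rewrite /= mem_seq1.
    by rewrite mem_seq1 => /eqP ->.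
  rewrite !set1; apply => // o /=.
  by rewrite mem_seq1 => /eqP ->.
(* the countably many exceptional sets are gathered into one *)
have good : {ae P, forall w m, (0 < m)%N ->
    LTeps eps m w @[eps --> 0^'+] --> LT m w /\
    {for LT m w, continuous (Fi i F Sigma)}}.
  apply: ae_foralln => m; have [->|m0] := posnP m; first exact: aeW.
  by have := ccopies m m0; have := cont_LT m m0; apply: filterS2 => w cw xw _; split.
apply: filterS good => w wgood.
apply: cvg_robbins_monro => // m th th0 /andP[m0 _] Kth0 cth.
have [cx cF] := wgood m m0.
have Dth0 : (mgf_dom P0 (L 1))° th0 by exact: hKkappa.
apply: cvg_Hi => //.
- exact: kappa_continuous Dth0.
- exact: grad_kappa_continuous Dth0.
Qed.
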